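(* Let $(Z,d,\mu)$ be a compact, connected, Ahlfors regular metric measure space that satisfies the Combinatorial Loewner Property with exponent $Q_{CLP}\ge1$, and let $X$ be a hyperbolic filling of $Z$. Then for all $1\le p<Q_{CLP}$ and all positively separated open sets $A,B\subseteq Z$ we have $\mathrm{wcap}_p(A,B)=\infty$.
   Context: A metric measure space $(Z,d,\mu)$ ($\mu$ Borel regular) is Ahlfors $Q$-regular if there are $c,C>0$ with $cr^Q\le\mu(B(z,r))\le Cr^Q$ for all $z\in Z$, $0<r\le\operatorname{diam}(Z)$, and Ahlfors regular if this holds for some $Q$. The metric is rescaled so that $\operatorname{diam}(Z)=1$. A continuum is a compact connected set with more than one point. Relative distance: $\Delta(A,B)=\operatorname{dist}(A,B)/\min(\operatorname{diam}A,\operatorname{diam}B)$. Combinatorial Loewner Property. Fix $s>1$ and $\kappa\ge1$. For $k\in\mathbb{N}$, a finite graph $G_k=(V_k,E_k)$ is a $\kappa$-approximation on scale $k$ if each $v\in V_k$ corresponds to an open set $U_v\subseteq Z$, $Z=\bigcup_{v\in V_k}U_v$, vertices $v,w$ are joined by an edge iff $U_v\cap U_w\ne\emptyset$, for every $v\in V_k$ there is $z_v\in Z$ with $B(z_v,\kappa^{-1}s^{-k})\subseteq U_v\subseteq B(z_v,\kappa s^{-k})$, and $B(z_v,\kappa^{-1}s^{-k})\cap B(z_w,\kappa^{-1}s^{-k})=\emptyset$ for distinct $v,w\in V_k$. A function $\rho:V_k\to[0,\infty)$ is admissible for a family $\Gamma$ of paths in $Z$ if $\sum_{v:\,U_v\cap\gamma\ne\emptyset}\rho(v)\ge1$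 for all $\gamma\in\Gamma$, and $\mathrm{Mod}_p(\Gamma,G_k)=\inf\{\sum_{v\in V_k}\rho(v)^p:\rho\text{ admissible for }\Gamma\}$. $\mathrm{Mod}_p(A,B,G_k)$ denotes this quantity for the family of paths in $Z$ connecting $A$ and $B$. With $(G_k)_{k\in\mathbb{N}}$ a fixed sequence of $\kappa$-approximations on scale $k$ (same $s,\kappa$ for all $k$), $Z$ satisfies the Combinatorial Loewner Property with exponent $p>1$ if there exist decreasing functions $\phi,\psi:(0,\infty)\to(0,\infty)$ with $\lim_{t\to\infty}\phi(t)=\lim_{t\to\infty}\psi(t)=0$ such that for all disjoint continua $A,B\subseteq Z$ and all $k$ with $s^{-k}\le\min\{\operatorname{diam}(A),\operatorname{diam}(B)\}$, $\phi(\Delta(A,B))\le\mathrm{Mod}_p(A,B,G_k)\le\psi(\Delta(A,B))$. Hyperbolic filling $X=(V_X,E_X)$: fix a scaling parameter $s>1$. For each $k\ge1$ choose a maximal $s^{-k}$-separated set $Z_k\subseteq Z$; each point of $Z_k$ gives a vertex $v$ of level $\ell(v)=k$ with associated ball $B_v=B(v,2s^{-k})$ of radius $r(B_v)=2s^{-k}$ (the same letter $v$ denotes the vertex and the center of its ball). On level $0$ there is a single vertex $O$ associated to all of $Z$. Distinct vertices $v,w$ are joined by an edge iff $|\ell(v)-\ell(w)|\le1$ and $B_v\cap B_w\neq\emptyset$. A path in $X$ is a sequence of vertices $(v_k)$ with consecutive vertices joined by edges, together with the edges $e_k$ joining $v_k$ to $v_{k+1}$. A one-sided infinite path converges to $z\in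 Z$ if $v_k\to z$ (centers) and $r(B_{v_k})\to0$; a two-sided infinite path can have a limit as $k\to\infty$ and one as $k\to-\infty$. Weak norm: for a countable set $S$ and $f:S\to[0,\infty)$, $\|f\|_{p,\infty}$ is the infimum of $C>0$ such that $\#\{x\in S:f(x)>\lambda\}\le C^p/\lambda^p$ for all $\lambda>0$ (value $\infty$ if there is none). Weak capacity: nonempty open sets $A,B\subseteq Z$ are positively separated if $\operatorname{dist}(A,B)>0$. A function $\tau:E_X\to[0,\infty)$ is admissible for $A,B$ if $\sum_{e\in\gamma}\tau(e)\ge1$ for every two-sided infinite path $\gamma$ with one limit in $A$ and the other in $B$. Then $\mathrm{wcap}_p(A,B)=\inf\{\|\tau\|_{p,\infty}^p:\tau\text{ admissible for }A,B\}\in[0,\infty]$. *)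

(* Defs.v *)
From HB Require Import structures.
From mathcomp Require Import all_boot all_order all_algebra.
From mathcomp Require Import all_classical all_reals all_analysis.

Set Implicit Arguments.
Unset Strict Implicit.
Unset Printing Implicit Defensive.

Import Order.TTheory GRing.Theory Num.Theory.
Import numFieldNormedType.Exports.

Local Open Scope classical_set_scope.
Local Open Scope ring_scope.

Section MetricSpaces.
Context {R : realType} {Z : metricType R}.
Implicit Types (A B : set Z).

(* Real-valued [sup] and [inf] return 0 on sets that have no supremum (resp.
   infimum); [diam] and [dist] are therefore meaningful only for nonempty
   (and, for [diam], bounded) sets.  The ambient space is always compact. *)
Definition diam A : R := sup [set mdist x y | x in A & y in A].

Definition dist A B : R := inf [set mdist x y | x in A & y in B].

Definition rel_dist A B : R := dist A B / Num.min (diam A) (diam B).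

Definition positively_separated A B := 0 < dist A B.

Definition continuum A :=
  [/\ compact A, connected A & exists x y, [/\ A x, A y & x <> y]].

Definition separated_set (e : R) (N : set Z) :=
  forall x y, N x -> N y -> x <> y -> e <= mdist x y.

Definition maximal_separated_set (e : R) (N : set Z) :=
  separated_set e N /\
  forall N', separated_set e N' -> N `<=` N' -> N' = N.

(* As usual for metric measure spaces, a Borel regular measure is an outer
   measure defined on all subsets. *)
Definition borel_regular (mu : {outer_measure set Z -> \bar R}) :=
  (forall U, <<s @open Z >> U -> mu.-caratheodory U) /\
  (forall A, exists U, [/\ <<s @open Z >> U, A `<=` U & mu U = mu A]).

Definition ahlfors_regular_of_dim (mu : {outer_measure set Z -> \bar R})
    (Q : R) :=
  exists c C : R, [/\ 0 < c, 0 < C &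
    forall (z : Z) (r : R), 0 < r -> r <= diam [set: Z] ->
      ((c * r `^ Q)%:E <= mu (ball z r))%E /\
      (mu (ball z r) <= (C * r `^ Q)%:E)%E].

Definition ahlfors_regular (mu : {outer_measure set Z -> \bar R}) :=
  exists Q : R, ahlfors_regular_of_dim mu Q.

(* A path in [Z] is a map continuous on [0, 1]; its values outside [0, 1] are
   irrelevant. *)
Definition is_path (g : R -> Z) := {within `[0, 1], continuous g}.

Definition path_image (g : R -> Z) : set Z := g @` `[0, 1].

Definition connecting_paths A B : set (R -> Z) :=
  [set g | [/\ is_path g, A (g 0) & B (g 1)]].

End MetricSpaces.

Section CombinatorialLoewner.
Context {R : realType} (Z : metricType R).

Record set_graph := SetGraph {
  verts : finType;
  adj : rel verts;
  vset : verts -> set Z }.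

Record approximation (s kappa : R) (k : nat) (G : set_graph) : Prop :=
  Approximation {
    approx_open : forall v, open (@vset G v);
    approx_cover : \bigcup_(v in [set: verts G]) vset v = [set: Z];
    approx_adj : forall v w : verts G,
      v != w -> (adj v w <-> vset v `&` vset w !=set0);
    approx_balls : exists z : verts G -> Z,
      (forall v, ball (z v) (kappa^-1 * s ^- k) `<=` vset v /\
                 vset v `<=` ball (z v) (kappa * s ^- k)) /\
      (forall v w, v <> w ->
         ball (z v) (kappa^-1 * s ^- k) `&` ball (z w) (kappa^-1 * s ^- k)
         = set0) }.

Definition mod_admissible (G : set_graph) (Gamma : set (R -> Z))
    (rho : verts G -> R) :=
  (forall v, 0 <= rho v) /\
  forall g, Gamma g ->
    1 <= \sum_(v | `[< vset v `&` path_image g !=set0 >]) rho v.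

Definition Mod (p : R) (Gamma : set (R -> Z)) (G : set_graph) : \bar R :=
  ereal_inf [set (\sum_(v : verts G) rho v `^ p)%:E |
             rho in mod_admissible Gamma].

(* The parameters [s], [kappa] and the approximating sequence [G] are part of
   the data of the property, hence quantified existentially. *)
Definition combinatorial_Loewner (p : R) :=
  1 < p /\
  exists (s kappa : R) (G : nat -> set_graph),
  [/\ 1 < s, 1 <= kappa, (forall k, approximation s kappa k (G k)) &
   exists phi psi : R -> R,
   [/\ (forall t, 0 < t -> 0 < phi t /\ 0 < psi t),
       (forall t u, 0 < t -> t <= u -> phi u <= phi t /\ psi u <= psi t),
       phi t @[t --> +oo] --> (0 : R), psi t @[t --> +oo] --> (0 : R) &
       forall (A B : set Z) (k : nat),
         continuum A -> continuum B -> A `&` B = set0 ->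
         s ^- k <= Num.min (diam A) (diam B) ->
         ((phi (rel_dist A B))%:E <= Mod p (connecting_paths A B) (G k))%E /\
         (Mod p (connecting_paths A B) (G k) <= (psi (rel_dist A B))%:E)%E]].

End CombinatorialLoewner.

Section HyperbolicFilling.
Context {R : realType} (Z : metricType R).

(* A vertex is a pair (level, center).  The single vertex of level 0 needs no
   center; it is labelled by an arbitrary point of [Z], its set is all of [Z]
   whatever the label, and no convergent path visits it infinitely often. *)
Record hyperbolic_filling := HyperbolicFilling {
  scale : R;
  net : nat -> set Z;
  scale_gt1 : 1 < scale;
  net_root : exists o, net 0%N = [set o];
  net_maximal : forall k, (0 < k)%N ->
    maximal_separated_set (scale ^- k) (net k) }.

Variable X : hyperbolic_filling.
Implicit Types (v w : nat * Z).

Definition fvertex : set (nat * Z) := [set v | net X v.1 v.2].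

Definition fradius v : R := 2 * scale X ^- v.1.

Definition fball v : set Z :=
  if v.1 == 0%N then [set: Z] else ball v.2 (fradius v).

Definition fadj v w :=
  [/\ fvertex v, fvertex w, v <> w,
      (v.1 <= w.1.+1)%N /\ (w.1 <= v.1.+1)%N & fball v `&` fball w !=set0].

(* An edge is the unordered pair of its endpoints. *)
Definition fedge : set (set (nat * Z)) :=
  [set e | exists v w, fadj v w /\ e = [set v; w]].

Definition converges_to (u : nat -> nat * Z) (z : Z) :=
  ((u n).2 @[n --> \oo] --> z) /\
  (fradius (u n) @[n --> \oo] --> (0 : R)).

Definition two_sided_path (u : int -> nat * Z) :=
  forall k : int, fadj (u k) (u (k + 1)).

Definition limits (u : int -> nat * Z) (a b : Z) :=
  converges_to (fun n : nat => u (- n%:Z)) a /\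
  converges_to (fun n : nat => u n%:Z) b.

Definition path_joins (A B : set Z) (u : int -> nat * Z) :=
  two_sided_path u /\
  exists a b, [/\ A a, B b & limits u a b \/ limits u b a].

(* Sums along a path are taken over the sequence of its edges, so an edge
   counts as often as it is traversed. *)
Definition wcap_admissible (A B : set Z) (tau : set (nat * Z) -> R) :=
  (forall e, fedge e -> 0 <= tau e) /\
  forall u, path_joins A B u ->
    (1 <= \esum_(k in [set: int]) (tau [set u k; u (k + 1)])%:E)%E.

End HyperbolicFilling.

Definition weak_norm (R : realType) (T : choiceType) (S : set T) (p : R)
    (f : T -> R) : \bar R :=
  ereal_inf [set C%:E | C in [set C : R | 0 < C /\
    forall lambda : R, 0 < lambda ->
      (counting [set x | S x /\ (lambda < f x)%R]
       <= (C `^ p / lambda `^ p)%:E)%E]].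

Definition wcap (R : realType) (Z : metricType R) (X : hyperbolic_filling Z)
    (p : R) (A B : set Z) : \bar R :=
  ereal_inf [set poweR (weak_norm (fedge X) p tau) p |
             tau in wcap_admissible X A B].

(* Main.v *)
Require Import Defs.
From HB Require Import structures.
From mathcomp Require Import all_boot all_order all_algebra.
From mathcomp Require Import all_classical all_reals all_analysis.
From mathcomp Require Import lra ring zify.

(* Let Q be the Loewner exponent. A function tau that is admissible for A, B and
   of finite weak l^p norm, p < Q, belongs to l^Q, so the sum of tau^Q over the
   edges of level at least n tends to 0. Two consequences make a path from A to
   B of tau-length less than 1. Vertically, connectedness provides two disjoint
   families of descendants below every vertex; always descending into the family
   of smaller mass halves the mass of tau^Q at a fixed rate, so every vertex of
   high level starts a ray of small tau-length. Horizontally, A and B contain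
   continua by boundary bumping, and the Loewner lower bound on Mod_Q at a scale
   comparable to s^-n rules out that all chains of level n between them are
   long, because their weight has small l^Q norm. *)

Set Implicit Arguments.
Unset Strict Implicit.
Unset Printing Implicit Defensive.

Import Order.TTheory GRing.Theory Num.Theory.
Import numFieldNormedType.Exports.

Local Open Scope classical_set_scope.
Local Open Scope ring_scope.

(** * Continua in compact connected metric spaces *)

Section MetricContinua.
Context {R : realType} {Z : metricType R}.
Implicit Types (A P K : set Z) (x y z : Z) (r e : R).

Lemma open_mdistP A x : open A -> A x ->
  exists2 e, 0 < e & forall y, mdist x y < e -> A y.
Proof.
move=> oA Ax; have /nbhs_ballP[e /= e0 Ae] := open_nbhs_nbhs (conj oA Ax).
by exists e => // y xy; apply: Ae; rewrite ballEmdist.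
Qed.

Lemma mdist_open A :
  (forall x, A x -> exists2 e, 0 < e & forall y, mdist x y < e -> A y) ->
  open A.
Proof.
move=> hA; rewrite openE => x /hA[e e0 Ae]; apply/nbhs_ballP; exists e => //=.
by move=> y; rewrite ballEmdist => /Ae.
Qed.

Lemma closed_mdistP A x : closed A ->
  (forall e, 0 < e -> exists2 y, A y & mdist x y < e) -> A x.
Proof.
move=> cA h; apply: cA => B /nbhs_ballP[e /= e0 Be].
have [y Ay xy] := h _ e0; exists y; split => //.
by apply: Be; rewrite ballEmdist.
Qed.

Lemma mdist_closed A :
  (forall x, (forall e, 0 < e -> exists2 y, A y & mdist x y < e) -> A x) ->
  closed A.
Proof.
move=> h; rewrite -(setCK A); apply/open_closedC/mdist_open => x nAx.
apply: contrapT => /forall2NP hn; apply: nAx; apply: h => e e0.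
have [//|hne] := hn e.
have /existsNP[y /not_implyP[xy /contrapT Ay]] := hne.
by exists y.
Qed.

(** A cluster point stands in for the limit of a subsequence: closeness at arbitrarily late indices
    is all that is used later. *)
Lemma compact_seq_cluster K (u : nat -> Z) : compact K ->
  (forall n, K (u n)) ->
  exists2 z, K z & forall e N, 0 < e -> exists2 n, (N <= n)%N & mdist z (u n) < e.
Proof.
move=> cK Ku; have [|z [Kz zu]] := cK (u @ \oo) _.
  by exists 0%N => // n _; exact: Ku.
exists z => // e N e0.
have [||y [[n Nn <-]]] :=
  zu [set u n | n in [set n | (N <= n)%N]] (ball z e).
- by exists N => //= n /= Nn; exists n.
- exact: nbhsx_ballx.
- by rewrite ballEmdist => zn; exists n.
Qed.

(* [y] is reached from [x] by steps shorter than [e] that land in [K]; the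
   impredicative form makes every use a choice of invariant [P]. *)
Definition chain e K x y :=
  forall P, P x -> (forall z w, P z -> K w -> mdist z w < e -> P w) -> P y.

Lemma chain_refl e K x : chain e K x x.
Proof. by move=> P. Qed.

Lemma chain_step e K x y z : chain e K x y -> K z -> mdist y z < e ->
  chain e K x z.
Proof. by move=> xy Kz yz P Px Ps; apply: (Ps y z _ Kz yz); exact: xy. Qed.

Lemma chain_le e e' K x y : e <= e' -> chain e K x y -> chain e' K x y.
Proof.
move=> ee' xy P Px Ps; apply: (xy P) => // z w Pz Kw zw; apply: (Ps z w) => //.
exact: lt_le_trans zw ee'.
Qed.

Lemma chain_sub e K x y : K x -> chain e K x y -> K y.
Proof. by move=> Kx xy; apply: (xy K). Qed.

Lemma chain_exit e K x y P : chain e K x y -> P x -> ~ P y ->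
  exists z w, [/\ P z, chain e K x w, K w, ~ P w & mdist z w < e].
Proof.
move=> xy Px nPy; apply: contrapT => h.
suff [] : P y /\ chain e K x y by [].
apply: (xy (fun w => P w /\ chain e K x w)); first by split => //; exact: chain_refl.
move=> z w [Pz xz] Kw zw; have xw := chain_step xz Kw zw; split => //.
by apply: contrapT => nPw; apply: h; exists z, w.
Qed.

(** For compact [K] containing [x] this is the connected component of [x] in [K]. *)
Definition quasi_component K x := [set y | forall e, 0 < e -> chain e K x y].

Lemma natSinv_lt e : 0 < e ->
  exists N, forall n, (N <= n)%N -> n.+1%:R^-1 < e.
Proof.
by move=> e0; have [N _ h] := near_infty_natSinv_lt (PosNum e0); exists N.
Qed.

Lemma quasi_component_cluster K x (u : nat -> Z) z : K z ->
  (forall n, chain n.+1%:R^-1 K x (u n)) ->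
  (forall e N, 0 < e -> exists2 n, (N <= n)%N & mdist z (u n) < e) ->
  quasi_component K x z.
Proof.
move=> Kz uK hz e e0; have [N hN] := natSinv_lt e0.
have [n Nn zn] := hz e N e0.
by apply: (chain_step (y := u n)) => //; [exact: chain_le (ltW (hN n Nn)) (uK n)|
  rewrite metric_sym].
Qed.

Lemma quasi_component_closed K x : K x -> closed K ->
  closed (quasi_component K x).
Proof.
move=> Kx cK; apply: mdist_closed => y h e e0.
have [z zK yz] := h e e0; apply: (chain_step (zK e e0)); last by rewrite metric_sym.
apply: closed_mdistP => // e' e'0; have [w wK yw] := h e' e'0; exists w => //.
exact: chain_sub (wK e e0).
Qed.

(** Otherwise there are pairs at distances tending to 0; their first points cluster in [P], and
    closedness puts the cluster point in [P'] as well. *)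
Lemma compact_disjoint_separated P P' : compact P -> closed P' ->
  P `&` P' = set0 ->
  exists2 e, 0 < e & forall x y, P x -> P' y -> e <= mdist x y.
Proof.
move=> cP cP' PP'; apply: contrapT => h.
have h' n : exists xy, [/\ P xy.1, P' xy.2 & mdist xy.1 xy.2 < n.+1%:R^-1].
  apply: contrapT => hn; apply: h; exists n.+1%:R^-1; first by rewrite invr_gt0.
  move=> x y Px P'y; rewrite leNgt; apply/negP => xy.
  by apply: hn; exists (x, y).
have [u hu] := choice h'.
have [|z Pz hz] := @compact_seq_cluster P (fun n => (u n).1) cP.
  by move=> n; have [] := hu n.
suff : (P `&` P') z by rewrite PP'.
split => //; apply: closed_mdistP => // e e0.
have e20 : 0 < e / 2 by rewrite divr_gt0.
have [N hN] := natSinv_lt e20; have [n Nn /= zn] := hz _ N e20.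
have [_ P'n un] := hu n; exists (u n).2 => //.
have := metric_triangle z (u n).1 (u n).2; have := lt_trans un (hN n Nn); lra.
Qed.

(* If a quasi-component split into closed pieces [P] and [P'], ever finer chains
   would have to jump from near [P] to far from it; the jumping points
   accumulate at a point of the quasi-component that is in neither piece. *)
Lemma quasi_component_clopen K x P P' : compact K -> closed K -> K x ->
  closed P -> closed P' -> P `&` P' = set0 ->
  quasi_component K x `<=` P `|` P' -> P `<=` K -> P x ->
  quasi_component K x `<=` P.
Proof.
move=> coK cK Kx cP cP' PP' CPP' PK Px q Cq; apply: contrapT => nPq.
have [e e0 he] :=
  compact_disjoint_separated (subclosed_compact cP coK PK) cP' PP'.
have P'q : P' q by have [] := CPP' q Cq.
pose D := [set y | exists2 z, P z & mdist z y < e / 2].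
have e20 : 0 < e / 2 by rewrite divr_gt0.
have Dx : D x by exists x => //; rewrite mdistxx.
have nDq : ~ D q by move=> [z Pz zq]; have := he z q Pz P'q; lra.
have h n : exists yz, [/\ D yz.1, chain n.+1%:R^-1 K x yz.2, K yz.2, ~ D yz.2 &
    mdist yz.1 yz.2 < n.+1%:R^-1].
  have n0 : 0 < n.+1%:R^-1 :> R by rewrite invr_gt0.
  have [y [z hyz]] := chain_exit (Cq _ n0) Dx nDq.
  by exists (y, z).
have [u hu] := choice h.
have [n|z Kz hz] := @compact_seq_cluster K (fun n => (u n).2) coK.
  by have [] := hu n.
have Cz : quasi_component K x z.
  apply: (quasi_component_cluster Kz _ hz) => n.
  by have [] := hu n.
have [Pz|P'z] := CPP' z Cz.
- have [n _ /= zn] := hz _ 0%N e20; have [_ _ _ nD _] := hu n.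
  by apply: nD; exists z.
- have e40 : 0 < e / 4 by rewrite divr_gt0.
  have [N hN] := natSinv_lt e40; have [n Nn /= zn] := hz _ N e40.
  have [[p Pp pn] _ _ _ un] := hu n.
  have := he p z Pp P'z; have := lt_trans un (hN n Nn).
  have := metric_triangle p (u n).1 z; have := metric_triangle (u n).1 (u n).2 z.
  rewrite (metric_sym (u n).2 z); lra.
Qed.

(** A relatively clopen [B] and its complement are both closed in [Z], so [quasi_component_clopen]
    applies to whichever contains [x]; for the complement the outcome contradicts [b]. *)
Lemma quasi_component_connected K x : compact K -> closed K -> K x ->
  connected (quasi_component K x).
Proof.
move=> coK cK Kx B [b Bb] [U oU BU] [F cF BF].
set C := quasi_component K x.
have cC : closed C by exact: quasi_component_closed.
have CK : C `<=` K; first by move=> y /(_ 1 ltr01); exact: chain_sub.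
have cB : closed B by rewrite BF; exact: closedI.
have cB' : closed (C `\` U) by apply: closedI => //; exact: open_closedC.
have BB' : B `&` (C `\` U) = set0.
  by rewrite -subset0 => y []; rewrite BU => -[_ Uy] [].
have CBB' : C `<=` B `|` (C `\` U).
  by move=> y Cy; have [Uy|nUy] := pselect (U y); [left; rewrite BU|right].
have Cx : C x by move=> e e0; exact: chain_refl.
apply/seteqP; split; first by rewrite BU => y [].
have [Bx|[_ nUx]] := CBB' x Cx.
  by apply: (quasi_component_clopen coK cK Kx cB cB') => //; rewrite BU => y [/CK].
have : C `<=` C `\` U.
  apply: (quasi_component_clopen coK cK Kx cB' cB) => //.
  - by rewrite setIC.
  - by move=> y /CBB'; rewrite setUC.
  - by move=> y [/CK].
move: Bb; rewrite {1}BU => -[Cb Ub] /(_ b Cb)[_ nUb]; exact: absurd.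
Qed.

Lemma closed_mball x r : closed [set y | mdist x y <= r].
Proof.
apply: mdist_closed => y h /=; rewrite leNgt; apply/negP => ry.
have [|z /= xz yz] := h (mdist x y - r); first by rewrite subr_gt0.
have := metric_triangle x z y; rewrite (metric_sym z y); lra.
Qed.

(** The continuum is the quasi-component of [x] in the closed ball of radius [r]. Chains of every
    fineness get as far as [r / 2], since otherwise the points they reach form a proper clopen
    subset of [Z]; a cluster point of their ends is a second point. *)
Lemma boundary_bumping x r y : compact [set: Z] -> connected [set: Z] ->
  0 < r -> r < mdist x y ->
  exists C, [/\ continuum C, C x & forall z, C z -> mdist x z <= r].
Proof.
move=> cZ coZ r0 rxy; pose K := [set z | mdist x z <= r].
have cK : closed K by exact: closed_mball.
have coK : compact K by exact: subclosed_compact cK cZ _.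
have Kx : K x by rewrite /K/= mdistxx ltW.
have cC := quasi_component_closed Kx cK.
have r20 : 0 < r / 2 by rewrite divr_gt0.
have Cx : quasi_component K x x by move=> e e0; exact: chain_refl.
have far e : 0 < e -> exists2 z, chain e K x z & r / 2 <= mdist x z.
  move=> e0; apply: contrapT => hn; pose C := chain e K x.
  have hC z : C z -> mdist x z < r / 2.
    by move=> Cz; rewrite ltNge; apply/negP => zr; apply: hn; exists z.
  (* The cap [r / 2] keeps a step taken from within [r / 2] of [x] inside [K]. *)
  pose e' := Num.min e (r / 2).
  have e'0 : 0 < e' by rewrite lt_min e0 r20.
  have CS z w : C z -> mdist z w < e' -> C w.
    move=> Cz; rewrite lt_min => /andP[ze zr]; apply: (chain_step Cz) => //.
    rewrite /K/=; have := metric_triangle x z w; have := hC z Cz; lra.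
  suff : C = setT by move=> CT; have := hC y; rewrite CT => /(_ I); lra.
  apply: coZ; first by exists x; exact: chain_refl.
  - exists C; last by rewrite setTI.
    by apply: mdist_open => z Cz; exists e' => // w; exact: CS.
  - exists C; last by rewrite setTI.
    apply: mdist_closed => z /(_ e' e'0)[w Cw zw].
    by apply: (CS w) => //; rewrite metric_sym.
have h n : exists z, chain n.+1%:R^-1 K x z /\ r / 2 <= mdist x z.
  by have [|z xz zr] := far n.+1%:R^-1; [rewrite invr_gt0|exists z].
have [u hu] := choice h.
have Ku n : K (u n) by apply: (chain_sub Kx (proj1 (hu n))).
have [z Kz hz] := compact_seq_cluster coK Ku.
exists (quasi_component K x); split => //; last first.
  by move=> w /(_ 1 ltr01)/(chain_sub Kx).
split.
- by apply: (subclosed_compact cC coK) => w /(_ 1 ltr01)/(chain_sub Kx).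
- exact: quasi_component_connected.
exists x, z; split => //.
  by apply: (quasi_component_cluster Kz _ hz) => n; have [] := hu n.
move=> xz; have [n _] := hz _ 0%N r20; have [_] := hu n.
by rewrite -xz; lra.
Qed.

(** * Distances in a space of diameter 1 *)

Hypothesis Zdiam : diam [set: Z] = 1.

Lemma mdist_le1 x y : mdist x y <= 1.
Proof.
(* [sup] is 0 where no supremum exists, so diameter 1 already forces distances to be bounded. *)
have hs : has_sup [set mdist x y | x in [set: Z] & y in [set: Z]].
  apply: contrapT => /sup_out h; move: Zdiam; rewrite /diam h => /eqP.
  by rewrite eq_sym oner_eq0.
rewrite -Zdiam; apply: sup_upper_bound => //.
by exists x => //; exists y.
Qed.

Lemma le_mdist_diam A x y : A x -> A y -> mdist x y <= diam A.
Proof.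
move=> Ax Ay; apply: sup_upper_bound; last by exists x => //; exists y.
split; first by exists (mdist x y); exists x => //; exists y.
by exists 1 => _ [a _ [b _ <-]]; exact: mdist_le1.
Qed.

Lemma continuum_diam_gt0 A : continuum A -> 0 < diam A.
Proof.
move=> [_ _ [x [y [Ax Ay xy]]]]; apply: lt_le_trans (le_mdist_diam Ax Ay).
by rewrite mdist_gt0; apply/eqP.
Qed.

Lemma dist_mono A B E F : E !=set0 -> F !=set0 -> E `<=` A -> F `<=` B ->
  dist A B <= dist E F.
Proof.
move=> [x Ex] [y Fy] EA FB; apply: lb_le_inf.
  by exists (mdist x y), x => //; exists y.
move=> _ [a Ea [b Fb <-]]; apply: ge_inf.
  by exists 0 => _ [c _ [d _ <-]]; exact: mdist_ge0.
by exists a; [exact: EA|exists b => //; exact: FB].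
Qed.

Lemma dist_gt0_disjoint A B : 0 < dist A B -> A `&` B = set0.
Proof.
move=> d0; rewrite -subset0 => x [Ax Bx].
have : dist A B <= mdist x x.
  apply: ge_inf; first by exists 0 => _ [c _ [d _ <-]]; exact: mdist_ge0.
  by exists x => //; exists x.
by rewrite mdistxx leNgt d0.
Qed.

Lemma ex_far x r : r < 1 / 2 -> exists y, r < mdist x y.
Proof.
move=> r1; apply: contrapT => h.
have hr y : mdist x y <= r.
  by rewrite leNgt; apply/negP => ry; apply: h; exists y.
suff : diam [set: Z] <= 2 * r by rewrite Zdiam; lra.
apply: ge_sup; first by exists (mdist x x), x => //; exists x.
move=> _ [a _ [b _ <-]]; have := metric_triangle a x b.
have := hr a; have := hr b; rewrite (metric_sym a x); lra.
Qed.

(** If the sphere were empty, the open ball would also be closed, hence all of [Z]. *)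
Lemma ex_sphere x r : connected [set: Z] -> 0 < r -> r < 1 / 2 ->
  exists y, mdist x y = r.
Proof.
move=> coZ r0 r1; apply: contrapT => h.
have hne y : mdist x y != r by apply/eqP => xy; apply: h; exists y.
have [y0 ry0] := ex_far x r1.
suff : [set y | mdist x y < r] = setT.
  by move=> /seteqP[_ /(_ y0 I)] /=; lra.
apply: coZ; first by exists x; rewrite /= mdistxx.
- exists [set y | mdist x y < r]; last by rewrite setTI.
  apply: mdist_open => y /= xy; exists (r - mdist x y); first by rewrite subr_gt0.
  move=> z yz; have := metric_triangle x y z; lra.
- exists [set y | mdist x y <= r]; first exact: closed_mball.
  rewrite setTI; apply/seteqP; split => y /=; first exact: ltW.
  by rewrite lt_neqAle hne.
Qed.

End MetricContinua.

(** * From weak [p]-summability to [q]-summability *)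

Section SummableMass.
Context {R : realType} {T : choiceType}.
Implicit Types (f : T -> R) (S : set T) (c p q : R).

(** For nonnegative [f] this bounds the unordered sum over [S], in a form that stays in [R]. *)
Definition mass_le f S c :=
  forall l : seq T, uniq l -> {in l, forall e, S e} -> \sum_(e <- l) f e <= c.

Lemma mass_le_sub f S S' c : S' `<=` S -> mass_le f S c -> mass_le f S' c.
Proof. by move=> SS' h l ul lS'; apply: h => // e /lS'/SS'. Qed.

Lemma mass_le_pt f S c e : mass_le f S c -> S e -> f e <= c.
Proof.
move=> /(_ [:: e] isT) h Se; have := h; rewrite big_seq1; apply => x.
by rewrite inE => /eqP ->.
Qed.

Lemma mass_le_half f S S1 S2 c : mass_le f S (2 * c) ->
  S1 `<=` S -> S2 `<=` S -> S1 `&` S2 = set0 ->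
  mass_le f S1 c \/ mass_le f S2 c.
Proof.
move=> h S1S S2S S12; apply: contrapT => /not_orP[].
move=> /existsNP[l1 /not_implyP[u1 /not_implyP[l1S /negP h1]]].
move=> /existsNP[l2 /not_implyP[u2 /not_implyP[l2S /negP h2]]].
have ul : uniq (l1 ++ l2).
  rewrite cat_uniq u1 u2 andbT /=; apply/hasPn => x xl2; apply/negP => xl1.
  suff : (S1 `&` S2) x by rewrite S12.
  by split; [exact: l1S|exact: l2S].
have : \sum_(e <- l1 ++ l2) f e <= 2 * c.
  by apply: h => // e; rewrite mem_cat => /orP[/l1S/S1S|/l2S/S2S].
by rewrite big_cat /=; move: h1 h2; rewrite -!ltNge; lra.
Qed.

(** Anything outside a finite list whose sum is within [e] of the supremum can add at most [e]. *)
Lemma mass_le_tail f S c e : mass_le f S c -> 0 < e ->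
  exists2 l : seq T, {in l, forall x, S x} & mass_le f [set x | S x /\ x \notin l] e.
Proof.
move=> h e0.
pose V := [set \sum_(x <- l) f x | l in
  [set l : seq T | uniq l /\ {in l, forall x, S x}]].
have hV : has_sup V.
  split; first by exists 0, [::] => //; rewrite big_nil.
  by exists c => _ [l [ul lS] <-]; exact: h.
have [_ [l [ul lS] <-] hl] := sup_adherent e0 hV.
exists l => // l' ul' l'S.
have : \sum_(x <- l ++ l') f x <= sup V.
  apply: sup_upper_bound => //; exists (l ++ l') => //; split.
    rewrite cat_uniq ul ul' andbT; apply/hasPn => x /l'S[_].
    by [].
  by move=> x; rewrite mem_cat => /orP[/lS|/l'S[]].
by rewrite big_cat /=; lra.
Qed.

Lemma powR_expn (x : R) q n : 0 <= x -> (x ^+ n) `^ q = (x `^ q) ^+ n.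
Proof.
move=> x0; elim: n => [|n ih]; first by rewrite !expr0 powR1.
by rewrite !exprS powRM// ?exprn_ge0// ih.
Qed.

Lemma powRV (x : R) q : 0 <= x -> x^-1 `^ q = (x `^ q)^-1.
Proof. by move=> x0; rewrite -powR_inv1// -powRrM mulN1r powRN. Qed.

Lemma size_le_counting S (l : seq T) (a : R) : uniq l ->
  {in l, forall x, S x} -> (counting S <= a%:E)%E -> (size l)%:R <= a.
Proof.
move=> ul lS; rewrite /counting; case: asboolP => // fS.
rewrite lee_fin; apply: le_trans; rewrite ler_nat.
apply: uniq_leq_size => // x /lS Sx.
by rewrite in_fset_set// inE.
Qed.

(* Dyadic decomposition: at most [2 ^ ((j + 1) p)] values lie in
   [(C 2 ^ -(j + 1), C 2 ^ -j]], so their [q]-th powers sum to a geometric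
   series of ratio [2 ^ (p - q)]. *)
Lemma weak_lp_mass_le f S p q (C : R) : 0 < p -> p < q -> 0 < C ->
  (forall x, S x -> 0 <= f x) ->
  (forall t : R, 0 < t ->
     (counting [set x | S x /\ (t < f x)%R] <= (C `^ p / t `^ p)%:E)%E) ->
  exists c, mass_le (fun x => f x `^ q) S c.
Proof.
move=> p0 pq C0 f0 hw.
pose b : R := 2^-1; have b0 : 0 < b by rewrite invr_gt0.
pose r := 2 `^ p * b `^ q.
have bq : b `^ q = (2 `^ q)^-1 by exact: powRV.
have r0 : 0 < r by rewrite mulr_gt0// powR_gt0.
have r1 : r < 1.
  rewrite /r bq ltr_pdivrMr ?powR_gt0// mul1r.
  have -> : q = p + (q - p) by lra.
  rewrite powRD; last by apply/implyP.
  rewrite ltr_pMr ?powR_gt0//.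
  have : 1 `^ (q - p) < 2 `^ (q - p) by rewrite gt0_ltr_powR ?nnegrE ?subr_gt0// ltr1n.
  by rewrite powR1.
(* [a * r ^+ J] is the [q]-th power of [C 2 ^ -J] times [2 ^ ((J + 1) p)]: the largest term of a
   dyadic layer times the bound on its size. *)
pose a := C `^ q * 2 `^ p.
have a0 : 0 < a by rewrite mulr_gt0// powR_gt0.
have count (l : seq T) (t : R) : 0 < t -> uniq l ->
    {in l, forall x, S x /\ t < f x} -> (size l)%:R <= C `^ p / t `^ p.
  by move=> t0 ul lS; apply: size_le_counting ul lS (hw t t0).
have key J (l : seq T) : uniq l ->
    {in l, forall x, S x /\ C * b ^+ J < f x} ->
    \sum_(x <- l) f x `^ q <= a * (1 - r ^+ J) / (1 - r).
  elim: J l => [|J ih] l ul lS.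
    (* No value exceeds [C]: at the threshold midway between [C] and [f x] the weak bound would
       count fewer than one point. *)
    case: l ul lS => [|x l] ul lS.
      by rewrite big_nil expr0 subrr mulr0 mul0r.
    have [Sx] := lS x (mem_head _ _); rewrite expr0 mulr1 => Cx.
    have fx := f0 _ Sx.
    have : (size [:: x])%:R <= C `^ p / ((C + f x) / 2) `^ p.
      apply: count => //; first lra.
      by move=> y; rewrite inE => /eqP ->; split => //; lra.
    have m0 : 0 < (C + f x) / 2 by lra.
    rewrite /= ler_pdivlMr ?powR_gt0// mul1r leNgt => /negP[].
    by rewrite gt0_ltr_powR ?nnegrE//; lra.
  pose P (x : T) := C * b ^+ J < f x.
  rewrite [leLHS](bigID P) /= -[X in X + _]big_filter -[X in _ + X]big_filter.
  have -> : a * (1 - r ^+ J.+1) / (1 - r) = a * (1 - r ^+ J) / (1 - r) + a * r ^+ J.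
    have r1' : 1 - r != 0 by rewrite subr_eq0 eq_sym lt_eqF.
    by rewrite exprS; field.
  apply: lerD.
    apply: ih; first exact: filter_uniq.
    by move=> x; rewrite mem_filter => /andP[Px /lS[]].
  set l' := [seq x <- l | ~~ P x].
  have hl' x : x \in l' -> [/\ S x, C * b ^+ J.+1 < f x & f x <= C * b ^+ J].
    by rewrite mem_filter /P -leNgt => /andP[Px /lS[]].
  apply: (@le_trans _ _ (\sum_(x <- l') (C * b ^+ J) `^ q)).
    rewrite !big_seq; apply: ler_sum => x /hl'[Sx _ xb].
    apply: ge0_ler_powR; rewrite ?nnegrE ?f0//; first lra.
    by rewrite mulr_ge0 ?exprn_ge0 ?ltW.
  rewrite big_const_seq count_predT iter_addr addr0 -mulr_natr.
  have hs : (size l')%:R <= C `^ p / (C * b ^+ J.+1) `^ p.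
    apply: count; first by rewrite mulr_gt0// exprn_gt0.
      exact: filter_uniq.
    by move=> x /hl'[].
  have -> : a * r ^+ J = (C * b ^+ J) `^ q * (C `^ p / (C * b ^+ J.+1) `^ p).
    have bp : b `^ p = (2 `^ p)^-1 by exact: powRV.
    have h1 : C `^ p != 0 by rewrite gt_eqF// powR_gt0.
    have h2 : 2 `^ p != 0 :> R by rewrite gt_eqF// powR_gt0.
    rewrite !powRM ?exprn_ge0 ?ltW// !powR_expn ?ltW// /a /r bp exprMn exprS.
    rewrite exprVn.
    move: (C `^ p) (2 `^ p) (C `^ q) ((b `^ q) ^+ J) (h1) (h2) => u v w t u0 v0.
    have vJ0 : v ^+ J != 0 by rewrite expf_neq0.
    move: (v ^+ J) vJ0 => vJ vJ0.
    by field; rewrite vJ0 v0 u0.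
  by rewrite ler_pM2l// powR_gt0// mulr_gt0// exprn_gt0.
exists (a / (1 - r)) => l ul lS.
(* The positive values of a finite list all lie above one dyadic threshold; the zero values
   contribute nothing. *)
have [J hJ] : exists J, {in l, forall x, 0 < f x -> C * b ^+ J < f x}.
  elim: l {ul lS} => [|x l [J ih]]; first by exists 0%N.
  have [fx|fx] := ltP 0 (f x); last first.
    exists J => y; rewrite inE => /orP[/eqP -> |/ih//].
    by rewrite ltNge fx.
  have [N _ hN] := near_infty_natSinv_expn_lt (PosNum (divr_gt0 fx C0)).
  exists (maxn J N) => y; rewrite inE => /orP[/eqP -> _|/ih h /h].
    have := hN (maxn J N) (leq_maxr _ _); rewrite /= ltr_pdivlMr// mulrC.
    by rewrite div1r -exprVn.
  apply: le_lt_trans; rewrite ler_pM2l//; apply: ler_wiXn2l; rewrite ?leq_maxl ?ltW//.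
  by rewrite /b invf_lt1// ltr1n.
pose P x := 0 < f x.
rewrite (bigID P) /= [X in _ + X]big1_seq ?addr0; last first.
  move=> x /andP[]; rewrite /P -leNgt => fx /lS/f0 fx0.
  have -> : f x = 0 by lra.
  by rewrite powR0// gt_eqF//; lra.
rewrite -big_filter; apply: (le_trans (key J _ _ _)).
- exact: filter_uniq.
- by move=> x; rewrite mem_filter => /andP[Px xl]; split; [exact: lS|exact: hJ].
- rewrite ler_pM2r ?invr_gt0 ?subr_gt0// ger_pMr// gerBl exprn_ge0// ltW//.
Qed.

End SummableMass.

(** * Packing in Ahlfors regular spaces *)

Section Packing.
Context {R : realType} {Z : metricType R}.
Variable mu : {outer_measure set Z -> \bar R}.

(** Splitting [X] along one measurable set at a time gives the inequality opposite to
    subadditivity. *)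
Lemma caratheodory_sum_le (I : eqType) (B : I -> set Z) (l : seq I) (X : set Z) :
  uniq l -> (forall i, mu.-caratheodory (B i)) ->
  (forall i j, i <> j -> B i `&` B j = set0) ->
  (\sum_(i <- l) mu (X `&` B i) <= mu X)%E.
Proof.
move=> + cB dB; elim: l X => [|i l ih] X /=; first by rewrite big_nil outer_measure_ge0.
move=> /andP[il ul]; rewrite big_cons (cB i X) leeD2l//.
rewrite (le_trans _ (ih (X `&` ~` B i) ul))//.
rewrite big_seq [leRHS]big_seq lee_sum// => j jl.
apply: le_outer_measure => x [Xx Bjx]; split => //; split => // Bix.
suff : (B i `&` B j) x by rewrite dB// => ij; rewrite ij jl in il.
by [].
Qed.

(** Compare measures: each small ball has measure at least c r^Q, and they are disjoint inside a
    ball of measure at most C d^Q. *)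
Lemma ahlfors_packing (T : R) : diam [set: Z] = 1 -> borel_regular mu ->
  ahlfors_regular mu -> 1 <= T ->
  exists N : R, forall (I : finType) (z : I -> Z) (P : {pred I}) (w : Z) (r d : R),
    0 < r -> r <= d -> d <= 1 -> d <= T * r ->
    (forall i j, i <> j -> ball (z i) r `&` ball (z j) r = set0) ->
    (forall i, P i -> ball (z i) r `<=` ball w d) ->
    #|P|%:R <= N.
Proof.
move=> Zdiam [bm _] [Q [c [C [c0 C0 hmu]]]] T1.
(* The absolute value covers either sign of [Q], as [d / r] lies between 1 and [T]. *)
exists (C * T `^ `|Q| / c) => I z P w r d r0 rd d1 dT disj sub.
have d0 : 0 < d by lra.
have cB i : mu.-caratheodory (ball (z i) r).
  apply: bm; apply: sub_sigma_algebra; apply: mdist_open => x.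
  rewrite ballEmdist /= => zx; exists (r - mdist (z i) x); first by rewrite subr_gt0.
  move=> y xy; have := metric_triangle (z i) x y; lra.
have := caratheodory_sum_le (ball w d) (enum_uniq P) cB disj.
rewrite Zdiam in hmu.
have [_ hd] := hmu w d d0 d1; move=> /le_trans/(_ hd) h.
have : (\sum_(i <- enum P) (c * r `^ Q)%:E <= (C * d `^ Q)%:E)%E.
  apply: le_trans h; rewrite big_seq [leRHS]big_seq; apply: lee_sum => i.
  rewrite mem_enum => Pi; rewrite setIidr; last exact: sub.
  by have [] := hmu (z i) r r0 (le_trans rd d1).
rewrite sumEFin lee_fin big_const_seq count_predT iter_addr addr0 -cardE.
rewrite -mulr_natr => {}h.
rewrite ler_pdivlMr//.
have rQ : 0 < r `^ Q by rewrite powR_gt0.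
rewrite -(ler_pM2r rQ); apply: (@le_trans _ _ (C * d `^ Q)); first lra.
rewrite -mulrA ler_pM2l//.
have -> : d `^ Q = (d / r) `^ Q * r `^ Q.
  by rewrite -powRM ?divr_ge0 ?ltW// divfK// gt_eqF.
rewrite ler_pM2r//.
have dr1 : 1 <= d / r by rewrite ler_pdivlMr// mul1r.
apply: (@le_trans _ _ ((d / r) `^ `|Q|)).
  by apply: ler_powR => //; exact: ler_norm.
apply: ge0_ler_powR; rewrite ?nnegrE//; [lra..|].
by rewrite ler_pdivrMr.
Qed.

End Packing.

(** * Rays of small length in the hyperbolic filling *)

Section Rays.
Context {R : realType} {Z : metricType R}.
Variable X : hyperbolic_filling Z.
Implicit Types (tau : set (nat * Z) -> R) (v w : nat * Z) (x y z : Z) (c : R).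

Local Notation s := (scale X).

Lemma scale_gt0 : 0 < s.
Proof. exact: lt_trans ltr01 (scale_gt1 X). Qed.

Lemma scale_inv_gt0 k : 0 < s ^- k.
Proof. by rewrite invr_gt0 exprn_gt0// scale_gt0. Qed.

Lemma scale_inv_le k l : (k <= l)%N -> s ^- l <= s ^- k.
Proof.
move=> kl; rewrite lef_pV2 ?posrE ?exprn_gt0 ?scale_gt0//.
by rewrite ler_weXn2l// ltW// scale_gt1.
Qed.

Lemma exprV_small (a e : R) : 1 < a -> 0 < e -> exists K, forall k, (K <= k)%N ->
  a ^- k < e.
Proof.
move=> a1 e0; have a0 : 0 < a by lra.
have /cvg_expr h : `|a^-1| < 1 by rewrite ger0_norm ?invr_ge0 ?ltW// invf_lt1.
have /cvgrPdist_lt/(_ _ e0)[K _ hK] := h.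
exists K => k /hK /=; rewrite sub0r normrN exprVn ger0_norm//.
by rewrite invr_ge0 exprn_ge0// ltW.
Qed.

(** A point too far from the whole net could be added to it, against maximality. *)
Lemma ex_net k x : (0 < k)%N -> exists y, net X k y /\ mdist y x < s ^- k.
Proof.
move=> /(net_maximal X)[sep maxi]; apply: contrapT => h.
have far y : net X k y -> s ^- k <= mdist y x.
  by move=> Ny; rewrite leNgt; apply/negP => yx; apply: h; exists y.
have sep' : separated_set (s ^- k) (net X k `|` [set x]).
  move=> a b [Na|->] [Nb|->] ab //; first exact: sep.
  - exact: far.
  - by rewrite metric_sym; exact: far.
have := maxi _ sep' (@subsetUl _ _ _) => /seteqP[/(_ x (or_intror erefl)) + _].
by move=> /far; rewrite mdistxx leNgt scale_inv_gt0.
Qed.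

Lemma common_fadj k l y y' x : (0 < k)%N -> (0 < l)%N -> net X k y -> net X l y' ->
  (k, y) <> (l, y') -> (k <= l.+1)%N -> (l <= k.+1)%N ->
  mdist y x < 2 * s ^- k -> mdist y' x < 2 * s ^- l -> fadj X (k, y) (l, y').
Proof.
move=> k0 l0 Ny Ny' ne kl lk yx y'x; split => //.
by exists x; rewrite /fball /= !gtn_eqF// !ballEmdist.
Qed.

(** Bounding finite partial sums keeps the length in [R] until two rays are glued. *)
Definition ray_to tau v z c := exists u : nat -> nat * Z,
  [/\ u 0%N = v, forall i, fadj X (u i) (u i.+1), converges_to X u z &
   forall n, \sum_(i < n) tau [set u i; u i.+1] <= c].

Lemma ray_to_cons tau v w z c : fadj X v w -> 0 <= tau [set v; w] ->
  ray_to tau w z c -> ray_to tau v z (tau [set v; w] + c).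
Proof.
move=> vw tau0 [u [u0 uadj [uz ur] usum]].
exists (fun i => if i is i'.+1 then u i' else v); split => //.
- by case=> [|i]; rewrite ?u0.
- by split=> A => [/uz|/ur] [N _ hN]; exists N.+1 => // -[//|i] /= Ni; exact: hN.
case=> [|n].
  by rewrite big_ord0 addr_ge0//; have := usum 0%N; rewrite big_ord0.
by rewrite big_ord_recl /= u0 lerD2l usum.
Qed.

Lemma two_sided_of_rays tau v a b c c' :
  (forall e, fedge X e -> 0 <= tau e) ->
  ray_to tau v a c -> ray_to tau v b c' ->
  exists u, [/\ two_sided_path X u, limits X u a b &
    (\esum_(k in [set: int]) (tau [set u k; u (k + 1)])%:E <= (c + c')%:E)%E].
Proof.
move=> tau0 [ua [ua0 ua_adj ua_lim ua_sum]] [ub [ub0 ub_adj ub_lim ub_sum]].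
(* [Negz n] is -(n + 1), so the common vertex sits at 0 and [ua] is traversed backwards from index 1
   on; edges being unordered, reversal keeps their weights. *)
pose u (k : int) := match k with Posz n => ub n | Negz n => ua n.+1 end.
have fadjC w w' : fadj X w w' -> fadj X w' w.
  move=> [h1 h2 h3 [h4 h5] h6]; split => //; first by move=> h; apply: h3.
  by rewrite setIC.
have uP n : u (n%:Z + 1) = ub n.+1 by rewrite -PoszD addn1.
have uN n : u (Negz n + 1) = ua n.
  case: n => [|n]; first by rewrite /= ub0 ua0.
  have -> : Negz n.+1 + 1 = Negz n by rewrite !NegzE; lia.
  by [].
have uadj : two_sided_path X u.
  by case=> n; [rewrite uP; exact: ub_adj|rewrite uN; apply: fadjC; exact: ua_adj].
exists u; split => //.
- split; last exact: ub_lim.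
  have -> : (fun n : nat => u (- n%:Z)) = ua; last by [].
  by apply/funext => -[|n]; [rewrite ua0 -ub0|rewrite -NegzE].
pose f (k : int) := (tau [set u k; u (k + 1)])%:E.
have f0 k : (0 <= f k)%E by rewrite lee_fin tau0//; exists (u k), (u (k + 1)).
have bnd (g : nat -> \bar R) (d : R) : (forall n, 0 <= g n)%E ->
    (forall n, \sum_(i < n) g i <= d%:E)%E ->
    (\sum_(0 <= i <oo | i \in [set: nat]) g i <= d%:E)%E.
  move=> g0 hg; apply: lime_le; first by apply: is_cvg_nneseries => n _ _; exact: g0.
  apply: nearW => n; apply: le_trans (hg n); rewrite big_mkord.
  by under eq_bigl do rewrite in_setT.
rewrite (esumID [set k | exists n, k = Posz n]); last by move=> k _; exact: f0.
rewrite -[leRHS]/(c%:E + c'%:E)%E addeC; apply: leeD.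
- have -> : [set: int] `&` ~` [set k | exists n, k = Posz n] = Negz @` [set: nat].
    apply/seteqP; split => [[n|n] [_ h]|_ [n _ <-]].
    - by exfalso; apply: h; exists n.
    - by exists n.
    - by split => // -[].
  rewrite esum_set_image; [|by move=> n _; exact: f0|by move=> ? ? _ _ []].
  apply: bnd => [n|n]; first exact: f0.
  apply: le_trans (_ : (\sum_(i < n) tau [set ua i; ua i.+1])%:E <= _)%E.
    rewrite sumEFin lee_fin le_eqVlt; apply/orP; left; apply/eqP.
    by apply: eq_bigr => i _; rewrite uN setUC.
  by rewrite lee_fin.
- have -> : [set: int] `&` [set k | exists n, k = Posz n] = Posz @` [set: nat].
    apply/seteqP; split => [_ [_ [n ->]]|_ [n _ <-]]; first by exists n.
    by split => //; exists n.
  rewrite esum_set_image; [|by move=> n _; exact: f0|by move=> ? ? _ _ []].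
  apply: bnd => [n|n]; first exact: f0.
  apply: le_trans (_ : (\sum_(i < n) tau [set ub i; ub i.+1])%:E <= _)%E.
    rewrite sumEFin lee_fin le_eqVlt; apply/orP; left; apply/eqP.
    by apply: eq_bigr => i _; rewrite uP.
  by rewrite lee_fin.
Qed.

Definition edges_from n : set (set (nat * Z)) :=
  [set e | fedge X e /\ forall v, e v -> (n <= v.1)%N].

(* The factor 3 makes room for the edges of a ray whose limit is within
   [3 / 2 * s ^- n] of [x], while the sets of two points at distance [s ^- n]
   become disjoint eight times finer. *)
Definition edges_near x n : set (set (nat * Z)) :=
  [set e | edges_from n e /\ forall v, e v -> mdist x v.2 < 3 * s ^- n].

Lemma edges_near_sub x y m n : 8 <= s ^+ m -> mdist x y <= s ^- n ->
  edges_near y (n + m) `<=` edges_near x n.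
Proof.
move=> m8 xy e [[ee le] he]; split.
  by split=> // v /le; apply: leq_trans; rewrite leq_addr.
move=> v /he yv; have := metric_triangle x y v.2; move: yv.
have : s ^- (n + m) <= s ^- n by rewrite scale_inv_le// leq_addr.
have : s ^- (n + m) <= s ^- n / 8.
  rewrite exprD invfM ler_pM2l ?scale_inv_gt0// lef_pV2 ?posrE//.
  by rewrite exprn_gt0// scale_gt0.
have := scale_inv_gt0 n; lra.
Qed.

Hypotheses (Zdiam : diam [set: Z] = 1) (Zconnected : connected [set: Z]).

(** The candidates are [x] and a point [y] at distance exactly [s ^- n]. Balls of radius
    [3 / 8 * s ^- n] about them are disjoint, so no edge is near both and one candidate has at most
    half the mass. *)
Lemma edges_near_half (f : set (nat * Z) -> R) x m n c :
  8 <= s ^+ m -> s ^- n < 1 / 2 -> mass_le f (edges_near x n) (2 * c) ->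
  exists y, mdist x y <= s ^- n /\ mass_le f (edges_near y (n + m)) c.
Proof.
move=> m8 n2 hf; have [y xy] := ex_sphere Zdiam x Zconnected (scale_inv_gt0 n) n2.
have hx : mdist x x <= s ^- n by rewrite mdistxx ltW// scale_inv_gt0.
have hy : mdist x y <= s ^- n by rewrite xy.
suff disj : edges_near x (n + m) `&` edges_near y (n + m) = set0.
  have [h|h] := mass_le_half hf (edges_near_sub m8 hx) (edges_near_sub m8 hy) disj.
    by exists x.
  by exists y.
rewrite -subset0 => e [[[[v [w [_ ev]]] _] he] [_ he']].
have evv : e v by rewrite ev; left.
have := he v evv; have := he' v evv; have := metric_triangle x v.2 y.
rewrite (metric_sym v.2 y) xy.
have : s ^- (n + m) <= s ^- n / 8.
  rewrite exprD invfM ler_pM2l ?scale_inv_gt0// lef_pV2 ?posrE//.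
  by rewrite exprn_gt0// scale_gt0.
have := scale_inv_gt0 n; lra.
Qed.

(** The blocks of [m] consecutive terms are dominated by a geometric series of ratio [l]. *)
Lemma sum_blocks_le (t : nat -> R) (m : nat) (e l : R) : (0 < m)%N ->
  0 <= e -> 0 <= l -> l < 1 -> (forall i, 0 <= t i) ->
  (forall i j, (j * m <= i)%N -> t i <= e * l ^+ j) ->
  forall n, \sum_(i < n) t i <= m%:R * e / (1 - l).
Proof.
move=> m0 e0 l0 l1 t0 ht n.
have key J : \sum_(0 <= i < J * m) t i <= m%:R * e * (1 - l ^+ J) / (1 - l).
  elim: J => [|J ih]; first by rewrite mul0n big_geq// expr0 subrr mulr0 mul0r.
  rewrite (big_cat_nat (n := (J * m)%N))//; last by rewrite leq_mul2r leqnSn orbT.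
  have -> : m%:R * e * (1 - l ^+ J.+1) / (1 - l) =
      m%:R * e * (1 - l ^+ J) / (1 - l) + e * l ^+ J * m%:R.
    have l1' : 1 - l != 0 by rewrite subr_eq0 eq_sym lt_eqF.
    by rewrite exprS; field.
  apply: lerD => //.
  apply: (@le_trans _ _ (\sum_(J * m <= i < J.+1 * m) e * l ^+ J)).
    by rewrite !big_nat; apply: ler_sum => i /andP[/ht].
  by rewrite sumr_const_nat mulSn addnK mulr_natr.
apply: (@le_trans _ _ (\sum_(0 <= i < n * m) t i)).
  rewrite -(big_mkord xpredT) (big_cat_nat (n := n) (p := (n * m)%N))//.
    by rewrite lerDl sumr_ge0.
  by rewrite leq_pmulr.
apply: le_trans (key n) _; rewrite ler_pM2r ?invr_gt0 ?subr_gt0//.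
by rewrite ler_piMr ?mulr_ge0// gerBl exprn_ge0.
Qed.

(* The limit [z] is reached through nested balls, each chosen among two disjoint
   candidates so as to halve the mass of [tau ^ Q]; every edge of the ray that
   descends to [z] past the j-th ball thus has [tau ^ Q <= e / 2 ^ j]. *)
Lemma ray_of_small_mass tau (Q : R) (eta : R) : compact [set: Z] ->
  0 < Q -> 0 < eta -> (forall e, fedge X e -> 0 <= tau e) ->
  exists2 e, 0 < e & forall n y, (0 < n)%N -> s ^- n < 1 / 2 -> net X n y ->
    mass_le (fun e => tau e `^ Q) (edges_from n) e ->
    exists z, mdist y z < 2 * s ^- n /\ ray_to tau (n, y) z eta.
Proof.
move=> Zcompact Q0 eta0 tau0.
have [m hm] : exists m, 8 <= s ^+ m.
  have [|m /(_ m (leqnn _))] := @exprV_small s 8^-1 (scale_gt1 X) _.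
    by rewrite invr_gt0.
  rewrite ltf_pV2 ?posrE ?exprn_gt0 ?scale_gt0// => /ltW; by exists m.
have m0 : (0 < m)%N by case: m hm => //; rewrite expr0; lra.
(* Halving the mass of tau^Q multiplies the bound on [tau] by [l], the [Q]-th root of 1/2; [e']
   below is chosen so that the resulting series is at most [eta]. *)
pose l : R := 2^-1 `^ Q^-1.
have l0 : 0 < l by rewrite powR_gt0 ?invr_gt0.
have l1 : l < 1.
  have : 2^-1 `^ Q^-1 < 1 `^ Q^-1 :> R.
    by rewrite gt0_ltr_powR ?nnegrE ?invr_gt0 ?invr_ge0//; lra.
  by rewrite powR1.
pose e' := eta * (1 - l) / m%:R.
have mR0 : 0 < m%:R :> R by rewrite ltr0n.
have e'0 : 0 < e' by rewrite divr_gt0 ?mulr_gt0 ?subr_gt0.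
exists (e' `^ Q); first by rewrite powR_gt0.
move=> n y n0 n2 Ny hmass.
pose a j := s ^- (n + j * m).
have a0 j : 0 < a j by exact: scale_inv_gt0.
have aS j : a j.+1 <= a j / 8.
  rewrite /a mulSn addnCA exprD invfM mulrC ler_pM2l ?scale_inv_gt0// lef_pV2 ?posrE//.
  by rewrite exprn_gt0// scale_gt0.
pose ml x j :=
  mass_le (fun e => tau e `^ Q) (edges_near x (n + j * m)) (e' `^ Q * 2 ^- j).
(* The mass bound is a premise inside the existential, so that choice applies to all pairs; [hml]
   maintains it along [xs]. *)
have step xj : exists x', ml xj.1 xj.2 -> mdist xj.1 x' <= a xj.2 /\ ml x' xj.2.+1.
  case: xj => x j /=; have [h|h] := pselect (ml x j); last by exists x.
  have [||x' [xx' hx']] := @edges_near_half (fun e => tau e `^ Q) x m (n + j * m)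
      (e' `^ Q * 2 ^- j.+1) hm.
  - by apply: le_lt_trans n2; rewrite scale_inv_le// leq_addr.
  - rewrite exprS invfM; move: h; rewrite /ml.
    suff -> : 2 * (e' `^ Q * (2^-1 * 2 ^- j)) = e' `^ Q * 2 ^- j by [].
    by rewrite mulrCA mulVKf.
  exists x' => _; split => //; rewrite /ml mulSn.
  by rewrite (addnC m) addnA.
have [nxt hnxt] := choice step.
pose fix xs j := if j is j'.+1 then nxt (xs j', j') else y.
have hml j : ml (xs j) j.
  elim: j => [|j ih] /=; last by have [] := hnxt (xs j, j) ih.
  rewrite /ml expr0 invr1 mulr1 mul0n addn0; apply: mass_le_sub hmass.
  by move=> e [].
have hd j : mdist (xs j) (xs j.+1) <= a j by have [] := hnxt (xs j, j) (hml j).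
(* [8 / 7] is the geometric series of ratio 1/8; an extra 1/8 for reaching the cluster point still
   stays below [3 / 2]. *)
have hdd t j : mdist (xs j) (xs (j + t)%N) <= 8 / 7 * a j.
  elim: t j => [|t ih] j; first by rewrite addn0 mdistxx; have := a0 j; lra.
  rewrite addnS -addSn; have := metric_triangle (xs j) (xs j.+1) (xs (j.+1 + t)%N).
  have := ih j.+1; have := hd j; have := aS j; lra.
have [//|z _ hz] := compact_seq_cluster (u := xs) Zcompact.
have zd j : mdist (xs j) z < 3 / 2 * a j.
  have aj8 : 0 < a j / 8 by have := a0 j; lra.
  have [i ji zi] := hz _ j aj8.
  have := metric_triangle (xs j) (xs i) z; rewrite (metric_sym (xs i)).
  have := hdd (i - j)%N j; rewrite subnKC//; have := a0 j; lra.
have [p hp] := choice (fun kx : nat * Z => ex_net kx.2 (ltn0Sn kx.1)).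
(* The ray follows net points close to [z], not the centres [xs]. As [p (k, z)] has level [k.+1],
   the vertex of index [i] has level [n + i]. *)
pose u i := if i is i'.+1 then ((n + i)%N, p ((n + i')%N, z)) else (n, y).
have uz i : (0 < i)%N -> net X (n + i) (u i).2 /\ mdist (u i).2 z < s ^- (n + i).
  by case: i => // i _; rewrite addnS; exact: (hp ((n + i)%N, z)).
have ulvl i : (u i).1 = (n + i)%N by case: i => [|i]; rewrite ?addn0.
have unet i : net X (n + i) (u i).2.
  by case: i => [|i]; [rewrite addn0|have [] := uz i.+1 isT].
have zy : mdist y z < 2 * s ^- n.
  by have := zd 0%N; rewrite /= /a mul0n addn0; have := scale_inv_gt0 n; lra.
have uz2 i : mdist (u i).2 z < 2 * s ^- (n + i).
  case: i => [|i]; first by rewrite addn0.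
  have [_] := uz i.+1 isT; have := scale_inv_gt0 (n + i.+1); lra.
have uadj i : fadj X (u i) (u i.+1).
  rewrite (surjective_pairing (u i)) (surjective_pairing (u i.+1)) !ulvl.
  apply: (@common_fadj _ _ _ _ z) => //.
  - by rewrite addn_gt0 n0.
  - by rewrite addn_gt0 n0.
  - by move=> -[]; lia.
  - lia.
  - lia.
(* Past index [j * m] the centres are within [3 / 2 + 1 < 3] times [a j] of [xs j]; index 0 occurs
   only for [j = 0], where the centre is [xs 0] itself. *)
have unear i j : (j * m <= i)%N -> edges_near (xs j) (n + j * m) [set u i; u i.+1].
  move=> ji; split; first split.
  - by exists (u i), (u i.+1).
  - by move=> v [->|->]; rewrite ulvl; lia.
  have hi k : (j * m <= k)%N -> (0 < k)%N -> mdist (xs j) (u k).2 < 3 * s ^- (n + j * m).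
    move=> jk k0; have [_] := uz k k0; have := zd j.
    have := metric_triangle (xs j) z (u k).2; rewrite (metric_sym z).
    have : s ^- (n + k) <= a j by rewrite scale_inv_le// leq_add2l.
    by rewrite -/(a j); have := a0 j; lra.
  move=> v [->|->]; last by apply: hi => //; lia.
  case: i ji => [|i] ji; last exact: hi.
  have -> : j = 0%N by move: ji; rewrite leqn0 muln_eq0 => /orP[/eqP//|/eqP]; lia.
  by rewrite /= mdistxx mulr_gt0// scale_inv_gt0.
have uedge i : fedge X [set u i; u i.+1] by exists (u i), (u i.+1).
exists z; split => //; exists u; split => //.
  split.
  - apply/cvg_ballP => e e0; have [K hK] := exprV_small (scale_gt1 X) e0.
    exists K.+1 => // i /= Ki; rewrite ballEmdist /= metric_sym.
    have [|_ h] := uz i; first lia.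
    by apply: lt_trans h _; apply: hK; lia.
  - apply/cvgrPdist_lt => e e0.
    have [|K hK] := @exprV_small s (e / 2) (scale_gt1 X) _; first lra.
    exists K => // i /= Ki; rewrite sub0r normrN /fradius ulvl ger0_norm.
      by have := hK (n + i)%N (leq_trans Ki (leq_addl _ _)); lra.
    by rewrite mulr_ge0// ltW// scale_inv_gt0.
have ht i j : (j * m <= i)%N -> tau [set u i; u i.+1] <= e' * l ^+ j.
  move=> ji; have := mass_le_pt (hml j) (unear i j ji).
  have -> : e' * l ^+ j = (e' `^ Q * 2 ^- j) `^ Q^-1.
    rewrite powRM ?powR_ge0//.
    by rewrite -powRrM mulfV ?gt_eqF// powRr1 ?ltW// -exprVn powR_expn.
  have {2}-> : tau [set u i; u i.+1] = (tau [set u i; u i.+1] `^ Q) `^ Q^-1.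
    by rewrite -powRrM mulfV ?gt_eqF// powRr1// tau0.
  move=> h; apply: ge0_ler_powR; rewrite ?nnegrE ?powR_ge0 ?invr_ge0 ?(ltW Q0)//.
  by rewrite mulr_ge0 ?powR_ge0 ?invr_ge0 ?exprn_ge0.
move=> k; have := sum_blocks_le m0 (ltW e'0) (ltW l0) l1 _ ht k.
have -> : m%:R * e' / (1 - l) = eta.
  by rewrite /e'; field; rewrite subr_eq0 eq_sym lt_eqF//= gt_eqF.
by apply => i; exact: tau0.
Qed.

End Rays.

(** * From paths in [Z] to horizontal paths in the filling *)

Section Horizontal.
Context {R : realType}.

(** Group the indices by their value under [e]: the values form a duplicate-free list in [S], each
    taken at most [N] times. *)
Lemma sum_fiber_le (I : finType) (T : choiceType) (e : I -> T) (P : pred I)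
    (f : T -> R) (S : set T) (c N : R) :
  mass_le f S c -> (forall t, S t -> 0 <= f t) -> (forall i, P i -> S (e i)) ->
  0 <= N -> (forall i0, P i0 -> #|[pred i | P i && (e i == e i0)]|%:R <= N) ->
  \sum_(i | P i) f (e i) <= N * c.
Proof.
move=> hf f0 PS N0 hN; pose l := undup [seq e i | i in P].
have lP t : t \in l -> exists2 i, P i & t = e i.
  by rewrite mem_undup => /fintype.imageP[i Pi ->]; exists i.
apply: (@le_trans _ _ (\sum_(t <- l) N * f t)); last first.
  rewrite -mulr_sumr ler_wpM2l//; apply: hf; first exact: undup_uniq.
  by move=> t /lP[i Pi ->]; exact: PS.
have -> : \sum_(i | P i) f (e i) = \sum_(i | P i) \sum_(t <- l | e i == t) f t.
  apply: eq_bigr => i Pi; rewrite -big_filter.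
  have -> : [seq t <- l | e i == t] = [:: e i].
    rewrite -(@filter_pred1_uniq _ l (e i)) ?undup_uniq//.
      by apply: seq.eq_filter => t /=; rewrite eq_sym.
    by rewrite mem_undup; apply/fintype.imageP; exists i.
  by rewrite big_seq1.
rewrite (exchange_big_dep xpredT)//= big_seq [leRHS]big_seq.
apply: ler_sum => t /lP[i0 Pi0 ->].
rewrite sumr_const -mulr_natl ler_wpM2r//; first exact/f0/PS.
exact: hN.
Qed.

Lemma sum_uniq_le (I : finType) (l : seq I) (P : pred I) (f : I -> R) :
  uniq l -> (forall i, 0 <= f i) -> {in l, forall i, P i} ->
  \sum_(i <- l) f i <= \sum_(i | P i) f i.
Proof.
move=> ul f0 lP; rewrite (big_uniq _ ul) /= big_mkcond [leRHS]big_mkcond /=.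
by apply: ler_sum => i _; case: ifP => [/lP ->|_]//; case: ifP.
Qed.

Context {Z : metricType R}.

Definition touch (I : Type) (U : I -> set Z) : rel I :=
  fun i j => `[< U i `&` U j !=set0 >].

(** The sets meeting the image and linked to [U i0] by overlaps have a union that is open and closed
    relative to the connected image, so it contains [g 1]. Removing loops ensures that each weight
    is counted once. *)
Lemma path_chain (I : finType) (U : I -> set Z) (g : R -> Z) :
  (forall i, open (U i)) -> (forall x, exists i, U i x) -> is_path g ->
  exists i0 l, [/\ uniq (i0 :: l), path (touch U) i0 l, U i0 (g 0),
    U (last i0 l) (g 1) &
    {in i0 :: l, forall i, `[< U i `&` path_image g !=set0 >]}].
Proof.
move=> oU cU cg; have [i0 Ui0] := cU (g 0).
pose K := path_image g; pose meet i := `[< U i `&` K !=set0 >].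
have K0 : K (g 0) by exists 0 => //=; rewrite in_itv /= lexx ler01.
have K1 : K (g 1) by exists 1 => //=; rewrite in_itv /= lexx ler01.
pose e : rel I := fun i j => meet j && touch U i j.
have coK : connected K.
  apply: connected_continuous_connected cg.
  by apply/connected_intervalP; exact: interval_is_interval.
pose V := \bigcup_(i in [set i | connect e i0 i]) U i.
pose V' := \bigcup_(i in [set i | meet i /\ ~ connect e i0 i]) U i.
have KV : K `&` V = K.
  apply: coK.
  - by exists (g 0); split => //; exists i0 => //=; exact: connect0.
  - by exists V => //; apply: bigcup_open => i _; exact: oU.
  (* A set that meets the image and overlaps a linked set is linked too, so [V'] is the complement
     of [V] within the image. *)
  - exists (~` V'); first by apply: open_closedC; apply: bigcup_open => i _; exact: oU.
    apply/seteqP; split => x [Kx hx]; split => //.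
    + move=> [j [mj nj] Ujx]; have [i /= ci Uix] := hx; apply: nj.
      apply: connect_trans ci _; apply: connect1; rewrite /e mj /=.
      by apply/asboolP; exists x.
    + have [i Uix] := cU x; exists i => //=; apply: contrapT => nci; apply: hx.
      by exists i => //; split => //; apply/asboolP; exists x.
have [_ [i /= /connectP[l pl il] Ui1]] : (K `&` V) (g 1) by rewrite KV.
move: il; case: (shortenP pl) => l' pl' ul' _ il.
exists i0, l'; split => //.
- by apply: sub_path pl' => j j' /andP[].
- by rewrite -il.
- move=> j; rewrite inE => /orP[/eqP ->|jl].
    by apply/asboolP; exists (g 0).
  elim: l' (i0) pl' jl {ul' il} => //= j1 l1 ih j0 /andP[/andP[m1 _] p1].
  by rewrite inE => /orP[/eqP ->//|]; exact: ih p1.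
Qed.

Variable X : hyperbolic_filling Z.
Implicit Types (tau : set (nat * Z) -> R).

(** [rho i] pays for the edge leaving [v i]; when consecutive indices share a vertex, the step is
    dropped. *)
Lemma ray_to_chain tau (I : eqType) (t : rel I) (v : I -> nat * Z) (rho : I -> R)
    i0 l z c :
  (forall e, fedge X e -> 0 <= tau e) -> (forall i, 0 <= rho i) ->
  (forall i j, t i j -> v i <> v j ->
    fadj X (v i) (v j) /\ tau [set v i; v j] <= rho i) ->
  path t i0 l -> ray_to X tau (v (last i0 l)) z c ->
  ray_to X tau (v i0) z (c + \sum_(i <- i0 :: l) rho i).
Proof.
have ray_le w a b : a <= b -> ray_to X tau w z a -> ray_to X tau w z b.
  move=> ab [u [u0 ua uz us]]; exists u; split => // n.
  exact: le_trans (us n) ab.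
move=> tau0 rho0 ht; elim: l i0 => [|i1 l ih] i0 /=.
  by move=> _; apply: ray_le; rewrite big_seq1 lerDl.
move=> /andP[t01 pl] /(ih _ pl) h; rewrite big_cons.
have [v01|v01] := pselect (v i0 = v i1).
  by rewrite v01; apply: ray_le h; have := rho0 i0; lra.
have [a01 le01] := ht _ _ t01 v01.
apply: (@ray_le _ (tau [set v i0; v i1] + (c + \sum_(i <- i1 :: l) rho i))).
  by lra.
by apply: ray_to_cons => //; apply: tau0; exists (v i0), (v i1).
Qed.

Lemma ex_max_weight (I : finType) (P : pred I) (f : I -> R) :
  (forall i, P i -> 0 <= f i) ->
  exists r, [/\ 0 <= r, forall i, P i -> f i <= r &
    r = 0 \/ exists2 i, P i & r = f i].
Proof.
move=> f0; have [[i0 Pi0]|nP] := pselect (exists i, P i); last first.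
  exists 0; split => //; last by left.
  by move=> i Pi; exfalso; apply: nP; exists i.
have [i Pi hi] := @Order.TotalTheory.arg_maxP _ _ _ i0 P f Pi0.
by exists (f i); split => //; [exact: f0|right; exists i].
Qed.

(** Take the least [k] satisfying the first bound; minimality gives the second, and [sigma < b]
    rules out [k = 0]. *)
Lemma ex_scale (a sigma : R) (b : R) : 1 < a -> 0 < sigma -> sigma < b ->
  exists k, b * a ^- k <= sigma /\ sigma <= b * a * a ^- k.
Proof.
move=> a1 s0 sb; have b0 : 0 < b by exact: lt_trans sb.
have a0 : 0 < a by lra.
have ex : exists k, b * a ^- k <= sigma.
  have [K hK] := exprV_small a1 (divr_gt0 s0 b0).
  by exists K; have := hK K (leqnn _); rewrite ltr_pdivlMr// mulrC => /ltW.
exists (ex_minn ex); case: ex_minnP => k hk kmin; split => //.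
case: k hk kmin => [|k] hk kmin.
  by move: hk; rewrite expr0 invr1 mulr1; lra.
rewrite leNgt; apply/negP => h.
suff : (k.+1 <= k)%N by rewrite ltnn.
by apply: kmin; move: h; rewrite exprS invfM mulrA mulfK ?gt_eqF// => /ltW.
Qed.

(** The margin [e] is kept because the limits of rays will fall near the continuum rather than on
    it. *)
Lemma continuum_in_open (A : set Z) : compact [set: Z] -> connected [set: Z] ->
  diam [set: Z] = 1 -> open A -> A !=set0 ->
  exists E e, [/\ continuum E, 0 < e, E `<=` A &
    forall x y, E x -> mdist x y < e -> A y].
Proof.
move=> cZ coZ dZ oA [a Aa]; have [e e0 Ae] := open_mdistP oA Aa.
pose r := Num.min (e / 2) (1 / 4).
have r0 : 0 < r by rewrite lt_min; apply/andP; split; lra.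
have re : r <= e / 2 by rewrite ge_min lexx.
have r2 : r < 1 / 2.
  by apply: (@le_lt_trans _ _ (1 / 4)); [rewrite ge_min lexx orbT|lra].
have [y ry] := ex_far dZ a r2.
have [E [cE Ea hE]] := boundary_bumping cZ coZ r0 ry.
exists E, (e / 2); split => //; first by lra.
  by move=> x /hE ax; apply: Ae; lra.
move=> x w /hE ax xw; apply: Ae; have := metric_triangle a x w; lra.
Qed.

End Horizontal.

(** * The weak capacity is infinite *)

Section Contradiction.
Context {R : realType} {Z : metricType R}.

(* The sets of the approximation are much smaller than the balls of level [n],
   so overlapping sets have adjacent (or equal) chosen net points, and each net
   point is chosen boundedly often. *)
Lemma approximation_weight (mu : {outer_measure set Z -> \bar R})
    (X : hyperbolic_filling Z) (s kappa : R) :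
  diam [set: Z] = 1 -> borel_regular mu -> ahlfors_regular mu ->
  1 < s -> 1 <= kappa ->
  exists2 N : R, 0 < N & forall (n k : nat) (G : set_graph Z)
    (f : set (nat * Z) -> R) (Q e : R),
    0 < Q -> (0 < n)%N -> scale X ^- n < 1 / 2 ->
    2 * kappa * s ^- k <= scale X ^- n ->
    scale X ^- n <= 2 * kappa * s * s ^- k ->
    Defs.approximation s kappa k G ->
    (forall t, fedge X t -> 0 <= f t) ->
    mass_le (fun t => f t `^ Q) (edges_from X n) e ->
    exists (v : verts G -> nat * Z) (rho : verts G -> R),
      [/\ forall i, [/\ (v i).1 = n, net X n (v i).2 &
            forall x, vset i x -> mdist (v i).2 x < 3 / 2 * scale X ^- n],
          forall i, 0 <= rho i,
          forall i j, touch (@vset _ _ G) i j -> v i <> v j ->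
            fadj X (v i) (v j) /\ f [set v i; v j] <= rho i &
          \sum_i rho i `^ Q <= N * e].
Proof.
move=> Zdiam mub mua s1 kappa1.
(* The constant bounds the ratio of [2 * scale X ^- n] to the inner radius [kappa^-1 * s ^- k]. *)
have [|N0 hN0] := @ahlfors_packing _ _ mu (4 * kappa ^+ 2 * s) Zdiam mub mua _.
  have : 1 <= kappa ^+ 2 by rewrite exprn_ege1.
  nra.
pose N := Num.max N0 1; have N1 : 1 <= N by rewrite le_max lexx orbT.
exists (2 * N); first lra.
move=> n k G f Q e Q0 n0 sig2 ksig sigk [oU cU _ [z [zU zdisj]]] f0 hf.
set sig := scale X ^- n in sig2 ksig sigk *.
have sig0 : 0 < sig by exact: scale_inv_gt0.
have sk0 : 0 < s ^- k by rewrite invr_gt0 exprn_gt0//; lra.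
have kU : kappa * s ^- k <= sig / 2 by lra.
have [w hw] := choice (fun i : verts G => ex_net X (z i) n0).
pose v i := (n, w i).
have vU i x : vset i x -> mdist (v i).2 x < 3 / 2 * sig.
  move=> Ux; have [_ /(_ x Ux)] := zU i; rewrite ballEmdist /= => zx.
  have [_] := hw i; have := metric_triangle (w i) (z i) x; rewrite -/sig; lra.
pose ok i j := touch (@vset _ _ G) i j && (v i != v j).
have okadj i j : ok i j -> fadj X (v i) (v j).
  move=> /andP[/asboolP[x [Uix Ujx]] /eqP vij].
  apply: (@common_fadj _ _ X n n _ _ x) => //.
  - by have [] := hw i.
  - by have [] := hw j.
  - have := vU i x Uix; rewrite -/sig /=; lra.
  - have := vU j x Ujx; rewrite -/sig /=; lra.
have okedge i j : ok i j -> edges_from X n [set v i; v j].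
  move=> /okadj vij; split; first by exists (v i), (v j).
  by move=> t [->|->].
(* [rho i] is the largest weight of an edge from [v i] to the net point of an overlapping set, or 0
   if there is none. *)
have hrho i := ex_max_weight (P := ok i) (f := fun j => f [set v i; v j])
  (fun j oij => f0 _ (proj1 (okedge i j oij))).
have [rho hr] := choice hrho.
exists v, rho; split.
- by move=> i; split => //; [have [] := hw i|exact: vU].
- by move=> i; have [] := hr i.
- move=> i j tij vij; have oij : ok i j by rewrite /ok tij; exact/eqP.
  by split; [exact: okadj|have [_ h _] := hr i; exact: h].
have [jm hjm] : exists jm : verts G -> verts G, forall i, 0 < rho i ->
    ok i (jm i) /\ rho i = f [set v i; v (jm i)].
  have h i : exists j, 0 < rho i -> ok i j /\ rho i = f [set v i; v j].
    have [_ _ [->|[j oij ->]]] := hr i; first by exists i; rewrite ltxx.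
    by exists j.
  by have [jm hjm] := choice h; exists jm.
have rho0 i : 0 <= rho i by have [] := hr i.
rewrite (bigID (fun i => 0 < rho i)) /= [X in _ + X]big1 ?addr0; last first.
  move=> i; rewrite -leNgt => ri; have -> : rho i = 0 by have := rho0 i; lra.
  by rewrite powR0// gt_eqF.
rewrite (eq_bigr (fun i => f [set v i; v (jm i)] `^ Q)); last first.
  by move=> i /hjm[_ {1}->].
pose E i := [set v i; v (jm i)].
apply: (@sum_fiber_le _ _ _ E _ (fun t => f t `^ Q) _ _ _ hf) => //.
- by move=> t _; exact: powR_ge0.
- by move=> i /hjm[/okedge].
- by lra.
move=> i0 ri0; have card a : #|[pred i | v i == a]|%:R <= N.
  have [[i1 /eqP vi1]|no] := pselect (exists i, v i == a); last first.
    rewrite eq_card0; first by lra.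
    by move=> i; rewrite !inE; apply/negP => h; apply: no; exists i.
  apply: (@le_trans _ _ N0); last by rewrite le_max lexx.
  have ik0 : 0 < kappa^-1 by rewrite invr_gt0; lra.
  have ik1 : kappa^-1 <= kappa.
    by apply: (@le_trans _ _ 1); rewrite // invf_le1//; lra.
  have ikk : kappa^-1 * s ^- k <= kappa * s ^- k by rewrite ler_pM2r.
  apply: (hN0 _ z _ a.2 (kappa^-1 * s ^- k) (2 * sig)).
  - by rewrite mulr_gt0.
  - by lra.
  - by lra.
  - have -> : 4 * kappa ^+ 2 * s * (kappa^-1 * s ^- k) = 2 * (2 * kappa * s * s ^- k).
      by move: (s ^- k) => q; field; rewrite gt_eqF//; lra.
    by lra.
  - by move=> i j ij; apply: zdisj.
  - move=> i /= /eqP via x; rewrite !ballEmdist /= => zx.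
    have [_] := hw i; have := metric_triangle (w i) (z i) x.
    by rewrite -via /= -/sig; lra.
(* If [i] yields the same edge as [i0], then [v i] is one of its two endpoints; hence the factor in
   [2 * N]. *)
apply: (@le_trans _ _ (#|[pred i | v i == v i0]|%:R + #|[pred i | v i == v (jm i0)]|%:R)).
  rewrite -natrD ler_nat -cardUI; apply: leq_trans (leq_addr _ _).
  apply: subset_leq_card; apply/fintype.subsetP => i; rewrite !inE => /andP[_ /eqP Ei].
  have : E i0 (v i) by rewrite -Ei; left.
  by move=> [->|->]; rewrite eqxx ?orbT.
by have := card (v i0); have := card (v (jm i0)); lra.
Qed.

(** If all paths had weight at least [eta], then [rho / eta] would be admissible with energy below
    [c]. *)
Lemma Mod_lt_path (p : R) (Gamma : set (R -> Z)) (G : set_graph Z)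
    (rho : verts G -> R) (eta c : R) :
  0 < eta -> (forall i, 0 <= rho i) ->
  (c%:E <= Mod p Gamma G)%E -> \sum_i rho i `^ p < c * eta `^ p ->
  exists2 g, Gamma g &
    \sum_(i | `[< vset i `&` path_image g !=set0 >]) rho i < eta.
Proof.
move=> eta0 rho0 cM hs; apply: contrapT => h.
have hg g : Gamma g -> eta <= \sum_(i | `[< vset i `&` path_image g !=set0 >]) rho i.
  by move=> Gg; rewrite leNgt; apply/negP => lt; apply: h; exists g.
have : (Mod p Gamma G <= (\sum_i (rho i / eta) `^ p)%:E)%E.
  apply: ereal_inf_lbound; exists (fun i => rho i / eta) => //; split.
    by move=> i; rewrite divr_ge0// ltW.
  by move=> g Gg; rewrite -mulr_suml ler_pdivlMr// mul1r; exact: hg.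
move=> /(le_trans cM); rewrite lee_fin leNgt => /negP; apply.
have -> : \sum_i (rho i / eta) `^ p = (\sum_i rho i `^ p) / eta `^ p.
  rewrite mulr_suml; apply: eq_bigr => i _.
  by rewrite powRM ?rho0 ?invr_ge0 ?ltW// powRV// ltW.
by rewrite ltr_pdivrMr// powR_gt0.
Qed.

(** All mass but [e] sits on finitely many edges, and high levels avoid these. *)
Lemma mass_le_edges_from (X : hyperbolic_filling Z) (f : set (nat * Z) -> R) (c e : R) :
  mass_le f (fedge X) c -> 0 < e ->
  exists n, forall m, (n <= m)%N -> mass_le f (edges_from X m) e.
Proof.
move=> hf e0; have [l lS hl] := mass_le_tail hf e0.
have [n hn] : exists n, {in l, forall t m, (n <= m)%N -> ~ edges_from X m t}.
  elim: l lS {hl} => [|t l ih] lS; first by exists 0%N.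
  have [|n hn] := ih; first by move=> x xl; apply: lS; rewrite inE xl orbT.
  have [v [w [_ tv]]] := lS t (mem_head _ _).
  exists (maxn n v.1.+1) => x; rewrite inE => /orP[/eqP ->|xl] m nm.
    move=> [_ /(_ v)]; rewrite {1}tv => /(_ (or_introl erefl)); lia.
  by apply: hn => //; lia.
exists n => m nm; apply: mass_le_sub hl => t tm; split; first by have [] := tm.
by apply/negP => tl; exact: hn tl m nm tm.
Qed.

Lemma weak_norm_admissible (mu : {outer_measure set Z -> \bar R}) (Q : R)
    (X : hyperbolic_filling Z) (p : R) (A B : set Z) tau :
  compact [set: Z] -> connected [set: Z] -> diam [set: Z] = 1 ->
  borel_regular mu -> ahlfors_regular mu -> combinatorial_Loewner Z Q ->
  1 <= p -> p < Q -> open A -> A !=set0 -> open B -> B !=set0 ->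
  positively_separated A B -> wcap_admissible X A B tau ->
  weak_norm (fedge X) p tau = +oo%E.
Proof.
move=> cZ coZ dZ mub mua [Q1 [s [kappa [G [s1 kappa1 happ [phi [psi]]]]]]].
move=> [phi0 _ _ _ hCLP] p1 pQ oA A0 oB B0 AB [tau0 hadm].
(* If no constant serves in the weak norm, its infimum is over the empty set. *)
suff no C : 0 < C -> ~ (forall t : R, 0 < t ->
    (counting [set x | fedge X x /\ (t < tau x)%R] <= (C `^ p / t `^ p)%:E)%E).
  rewrite /weak_norm -[RHS]ereal_inf0; congr ereal_inf.
  by rewrite -subset0 => _ [C [C0 /no] []].
move=> C0 hC.
have Q0 : 0 < Q by lra.
have [K hK] : exists K, mass_le (fun t => tau t `^ Q) (fedge X) K.
  by apply: weak_lp_mass_le pQ C0 tau0 hC; lra.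
have [E [eA [cE eA0 EA hE]]] := continuum_in_open cZ coZ dZ oA A0.
have [F [eB [cF eB0 FB hF]]] := continuum_in_open cZ coZ dZ oB B0.
have nE : E !=set0 by have [_ _ [x [_ [Ex _ _]]]] := cE; exists x.
have nF : F !=set0 by have [_ _ [x [_ [Fx _ _]]]] := cF; exists x.
have EF : 0 < dist E F by apply: lt_le_trans AB (dist_mono nE nF EA FB).
pose dm := Num.min (diam E) (diam F).
have dm0 : 0 < dm by rewrite lt_min !continuum_diam_gt0.
pose d := phi (rel_dist E F).
have d0 : 0 < d by have [] := phi0 (rel_dist E F) (divr_gt0 EF dm0).
(* Two rays and the horizontal chain cost at most 1/4 each, in total less than 1. *)
pose eta : R := 1 / 4; have eta0 : 0 < eta by rewrite /eta; lra.
have [e1 e10 hray] := ray_of_small_mass (X := X) dZ coZ cZ Q0 eta0 tau0.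
have [N N0 hN] := approximation_weight X dZ mub mua s1 kappa1.
(* This makes [N * e2] half of the Loewner threshold, whence the strict inequality required by
   [Mod_lt_path]. *)
pose e2 := d * eta `^ Q / (2 * N).
have etaQ : 0 < eta `^ Q by rewrite powR_gt0.
have e20 : 0 < e2 by rewrite divr_gt0 ?mulr_gt0.
have [n1 hn1] := mass_le_edges_from hK e10.
have [n2 hn2] := mass_le_edges_from hK e20.
(* The first two bounds keep points within [4 * sig] of [E] and [F] inside [A] and [B], [1 / 2]
   serves the spheres, and [dm] makes scale [k] admissible in the Loewner bound. *)
pose b := Num.min (Num.min (eA / 4) (eB / 4)) (Num.min (1 / 2) dm).
have b0 : 0 < b.
  by rewrite lt_min; apply/andP; split; rewrite lt_min; apply/andP; split; lra.
have [n3 hn3] := exprV_small (scale_gt1 X) b0.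
have [n [n1n n2n n3n n0]] : exists n, [/\ n1 <= n, n2 <= n, n3 <= n & 0 < n]%N.
  by exists (maxn (maxn n1 n2) n3.+1); rewrite !leq_max !leqnn ltn0Sn leqnSn !orbT.
set sig := scale X ^- n.
have : sig < b by exact: hn3.
rewrite lt_min => /andP[]; rewrite lt_min => /andP[sA sB].
rewrite lt_min => /andP[s2 sdm].
have sig0 : 0 < sig by exact: scale_inv_gt0.
have [|k [kl kr]] := ex_scale (b := 2 * kappa) s1 sig0 _; first lra.
have kdm : s ^- k <= dm.
  have : 0 < s ^- k by rewrite invr_gt0 exprn_gt0//; lra.
  by move=> sk0; apply: le_trans (ltW sdm); nra.
have m1 := hn1 n n1n; have m2 := hn2 n n2n.
have [v [rho [hv rho0 vadj rhoQ]]] :=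
  hN n k (G k) tau Q e2 Q0 n0 s2 kl kr (happ k) tau0 m2.
have [hMod _] := hCLP E F k cE cF (dist_gt0_disjoint EF) kdm.
have [|g [cg Eg Fg] rhog] := Mod_lt_path eta0 rho0 hMod.
  apply: le_lt_trans rhoQ _; rewrite -/d.
  have -> : N * e2 = d * eta `^ Q / 2 by rewrite /e2; field; lra.
  by have := mulr_gt0 d0 etaQ; lra.
have [oU cU _ _] := happ k.
have [||i0 [l [ul pl Ui0 Ul hl]]] :=
  @path_chain _ _ (verts (G k)) (@vset _ _ (G k)) g _ _ cg.
- exact: oU.
- by move=> x; have : [set: Z] x by []; rewrite -cU => -[i _ Ui]; exists i.
(* The net point is within [3 / 2 * sig] of [x] and the limit within [2 * sig] of the net point. *)
have near i x : vset i x -> exists z,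
    mdist x z < 4 * sig /\ ray_to X tau (v i) z eta.
  move=> Ux; have [v1 v2 v3] := hv i.
  have [z [yz hz]] := hray n (v i).2 n0 s2 v2 m1; exists z; split.
    have := metric_triangle x (v i).2 z; rewrite (metric_sym x (v i).2).
    by have := v3 x Ux; rewrite -/sig; move: yz; rewrite -/sig; lra.
  by move: hz; rewrite -v1 -surjective_pairing.
have [za [gza raya]] := near _ _ Ui0.
have [zb [gzb rayb]] := near _ _ Ul.
have Aza : A za by apply: hE Eg _; lra.
have Bzb : B zb by apply: hF Fg _; lra.
have rayb' := ray_to_chain tau0 rho0 vadj pl rayb.
have [u [upath ulim usum]] := two_sided_of_rays tau0 raya rayb'.
have : path_joins X A B u by split => //; exists za, zb; split => //; left.
move=> /hadm/le_trans/(_ usum); rewrite lee_fin.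
have := sum_uniq_le ul rho0 hl; move: rhog; rewrite /eta; lra.
Qed.

End Contradiction.

Theorem theorem1p5 (R : realType) (Z : metricType R)
    (mu : {outer_measure set Z -> \bar R}) (QCLP : R)
    (X : hyperbolic_filling Z)
    (Zcompact : compact [set: Z])
    (Zconnected : connected [set: Z])
    (Zdiam : diam [set: Z] = 1)
    (mu_borel : borel_regular mu)
    (mu_ahlfors : ahlfors_regular mu)
    (QCLP_ge1 : 1 <= QCLP)
    (Z_CLP : combinatorial_Loewner Z QCLP) :
  forall (p : R) (A B : set Z),
    1 <= p -> p < QCLP ->
    open A -> A !=set0 -> open B -> B !=set0 ->
    positively_separated A B ->
    wcap X p A B = +oo%E.
Proof.
move=> p A B p1 pQ oA A0 oB B0 AB; apply/ereal_inf_pinfty => _ [tau htau <-] /=.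
rewrite (weak_norm_admissible Zcompact Zconnected Zdiam mu_borel mu_ahlfors Z_CLP
  p1 pQ oA A0 oB B0 AB htau).
by rewrite poweRyr// gt_eqF//; lra.
Qed.
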